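(* Let $\mathcal R$ be a left-linear and left-value-free LCTRS and let $\Pi X.\,s\,[\exists\vec{x}.\varphi]$ be a satisfiable existentially constrained term. Then $\Pi X.\,s\,[\exists\vec{x}.\varphi]$ is a normal form with respect to $\to_{\mathcal R}$ if and only if for every $\rho\in\mathcal R$ and every position $p$ of $s$ there exists $u\in[\![\Pi X.\,s\,[\exists\vec{x}.\varphi]]\!]_{\mathsf v}$ such that there is no $v$ with $u\to^p_{[\![\rho]\!]}v$.
   Context: Terms are built over a sorted signature whose function symbols are split into theory symbols (whose argument and result sorts are theory sorts) and term symbols, and a set $\mathcal{V}$ of sorted variables; theory sorts and symbols are interpreted in a fixed model $\mathcal{M}$. Every element of the interpretation of each theory sort is a constant symbol, called a value; $\mathcal{V}al$ denotes the set of values. There is a theory sort of Booleans with standard interpretation and the usual connectives. A constraint is a Boolean-sorted term built from theory symbols and variables; a (possibly existentially quantified) formula is valid if it is true under all valuations of its free variables in $\mathcal{M}$ and satisfiable if true under some. $\mathcal{V}ar(\cdot)$ is the set of variables. A substitution $\sigma$ is a sort-preserving map from variables to terms with finite domain $\mathcal{D}om(\sigma)=\{x\mid \sigma(x)\neq x\}$; $\mathcal{V}Dom(\sigma)=\{x\mid\sigma(x)\in\mathcal{V}al\}$; $\sigma$ is $X$-valued if $\sigma(X)\subseteq\mathcal{V}al$. An existential constraint $\exists\vec{x}.\varphi$ is a sequence of variables $\vec x$ together with a constraint $\varphi$ with $\{\vec x\}\subseteq\mathcal{V}ar(\varphi)$; its free variables are $\mathcal{FV}ar(\exists\vec x.\varphi)=\mathcal{V}ar(\varphi)\setminus\{\vec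 x\}$. For a substitution $\sigma$, $\sigma\vDash_{\mathcal M}\exists\vec x.\varphi$ means $\sigma$ is $\mathcal{FV}ar(\exists\vec x.\varphi)$-valued and $(\exists\vec x.\varphi)\sigma$ is valid. An existentially constrained term $\Pi X.\,s\,[\exists\vec x.\varphi]$ consists of a set $X$ of variables, a term $s$ and an existential constraint with $\mathcal{FV}ar(\exists\vec x.\varphi)\subseteq X\subseteq\mathcal{V}ar(s)$ and $\{\vec x\}\cap\mathcal{V}ar(s)=\emptyset$; it is satisfiable if $\exists\vec x.\varphi$ is satisfiable. A constrained rewrite rule $\rho\colon \Pi Z.\,\ell\to r\,[\pi]$ consists of a set $Z$ of variables, terms $\ell,r$ of the same sort and a constraint $\pi$ with $\mathcal{V}ar(\pi)\cup(\mathcal{V}ar(r)\setminus\mathcal{V}ar(\ell))\subseteq Z$; it is left-linear if $\ell$ is linear and left-value-free if $\ell$ contains no values; $\mathcal{E}x\mathcal{V}ar(\rho)=\mathcal{V}ar(r)\setminus\mathcal{V}ar(\ell)$. Let $\Pi X.\,s\,[\exists\vec x.\varphi]$ be satisfiable, $\rho$ left-linear with $\mathcal{V}ar(\rho)\cap\mathcal{V}ar(s,\varphi)=\emptyset$, and $\{\vec z\}=\mathcal{V}ar(\pi)\setminus\mathcal{V}ar(\ell)$. The term has a $\rho$-redex at position $p$ of $s$ using $\gamma$ if (i) $\mathcal{D}om(\gamma)=\mathcal{V}ar(\ell)$, (ii) $s|_p=\ell\gamma$, (iii) $\gamma(x)\in\mathcal{V}al\cup X$ for all $x\in\mathcal{V}ar(\ell)\cap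 Z$, and (iv) $(\exists\vec x.\varphi)\Rightarrow(\exists\vec z.\pi\gamma)$ is valid; then, with $t=s[r\gamma]_p$, $\psi=\varphi\wedge\pi\gamma$, $\{\vec y\}=\mathcal{V}ar(\psi)\setminus\mathcal{V}ar(t)$, $Y=\mathcal{E}x\mathcal{V}ar(\rho)\cup(X\cap\mathcal{V}ar(t))$, there is a most general rewrite step $\Pi X.\,s\,[\exists\vec x.\varphi]\to^p_{\rho,\gamma}\Pi Y.\,t\,[\exists\vec y.\psi]$. One writes $\to_\rho$ if such a step exists for some position, some $\gamma$ and some renamed variant of $\rho$ whose variables are disjoint from those of the source term. An LCTRS $\mathcal R$ is a set of left-linear constrained rewrite rules (including the calculation rules for theory symbols); it is left-value-free if all its rules are; $\to_{\mathcal R}=\bigcup_{\rho\in\mathcal R}\to_\rho$; a constrained term is a normal form w.r.t. $\to_{\mathcal R}$ if it has no $\to_{\mathcal R}$-successor. For a set $R$ of pairs of ordinary terms, $u\to^p_R v$ means there are $\langle l,r'\rangle\in R$ and a substitution $\theta$ with $u|_p=l\theta$ and $v=u[r'\theta]_p$. Interpretation of a rule $\rho\colon\Pi Z.\,\ell\to r\,[\pi]$: $[\![\rho]\!]=\{\langle\ell\sigma,r\sigma\rangle\mid\mathcal{D}om(\sigma)=\mathcal{V}Dom(\sigma)=Z\cap\mathcal{V}ar(\ell,r),\ \sigma\vDash_{\mathcal M}\exists\vec z'.\pi\}$ where $\{\vec z'\}=\mathcal{V}ar(\pi)\setminus\mathcal{V}ar(\ell,r)$. Value interpretation: $[\![\Pi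 X.\,s\,[\exists\vec x.\varphi]]\!]_{\mathsf v}$ is the set of all terms $s\sigma$ where $\sigma$ is a substitution such that $\sigma(X)\subseteq\mathcal{V}al$, $\sigma(\mathcal{V}ar(s)\setminus X)\subseteq\mathcal V$, $\sigma(x)\neq\sigma(y)$ for distinct $x,y\in\mathcal{V}ar(s)\setminus X$, and $\sigma\vDash_{\mathcal M}\exists\vec x.\varphi$.
   Formalization: The variables in X (of the constrained term) and in Z (of the rules) are required to be of theory sorts; otherwise the value interpretation or the rule's interpretation can be empty and the equivalence fails. *)

(* Defs.v *)
From mathcomp Require Import all_boot.
From mathcomp Require Import boolp classical_sets functions cardinality.

Set Implicit Arguments.
Unset Strict Implicit.
Unset Printing Implicit Defensive.

Local Open Scope classical_set_scope.

(* A sorted signature, its variables and the fixed model of its theory part.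
   The carrier of a theory sort tau is { a : value | value_sort a = tau }, so
   the elements of the carriers are the values themselves.  [theory_sym] holds
   the theory symbols that are not values. *)
Record signature := Signature {
  sort : eqType;
  theory_sort : pred sort;
  bool_sort : sort;
  bool_sort_theory : theory_sort bool_sort;

  var : eqType;
  var_sort : var -> sort;
  var_infinite : forall tau, infinite_set [set x : var | var_sort x = tau];

  value : eqType;
  value_sort : value -> sort;
  value_sort_theory : forall a, theory_sort (value_sort a);
  carrier_nonempty :
    forall tau, theory_sort tau -> exists a, value_sort a = tau;

  theory_sym : eqType;
  theory_dom : theory_sym -> seq sort;
  theory_cod : theory_sym -> sort;
  theory_dom_theory : forall f, all theory_sort (theory_dom f);
  theory_cod_theory : forall f, theory_sort (theory_cod f);

  term_sym : eqType;
  term_dom : term_sym -> seq sort;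
  term_cod : term_sym -> sort;

  (* only meaningful on arguments of the sorts required by [theory_dom] *)
  theory_interp : theory_sym -> seq value -> value;
  theory_interp_sort : forall f args,
    map value_sort args = theory_dom f ->
    value_sort (theory_interp f args) = theory_cod f;

  bool_value : bool -> value;
  bool_value_inj : injective bool_value;
  bool_valueP :
    forall a, value_sort a = bool_sort <-> exists b, a = bool_value b;

  not_sym : theory_sym;
  not_symP :
    [/\ theory_dom not_sym = [:: bool_sort], theory_cod not_sym = bool_sort
      & forall a, theory_interp not_sym [:: bool_value a] = bool_value (~~ a)];
  and_sym : theory_sym;
  and_symP :
    [/\ theory_dom and_sym = [:: bool_sort; bool_sort],
        theory_cod and_sym = bool_sort
      & forall a b, theory_interp and_sym [:: bool_value a; bool_value b]
                    = bool_value (a && b)];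
  or_sym : theory_sym;
  or_symP :
    [/\ theory_dom or_sym = [:: bool_sort; bool_sort],
        theory_cod or_sym = bool_sort
      & forall a b, theory_interp or_sym [:: bool_value a; bool_value b]
                    = bool_value (a || b)];
  imp_sym : theory_sym;
  imp_symP :
    [/\ theory_dom imp_sym = [:: bool_sort; bool_sort],
        theory_cod imp_sym = bool_sort
      & forall a b, theory_interp imp_sym [:: bool_value a; bool_value b]
                    = bool_value (a ==> b)];
  iff_sym : theory_sym;
  iff_symP :
    [/\ theory_dom iff_sym = [:: bool_sort; bool_sort],
        theory_cod iff_sym = bool_sort
      & forall a b, theory_interp iff_sym [:: bool_value a; bool_value b]
                    = bool_value (a == b)];
  eq_sym : sort -> theory_sym;
  eq_symP : forall tau, theory_sort tau ->
    [/\ theory_dom (eq_sym tau) = [:: tau; tau],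
        theory_cod (eq_sym tau) = bool_sort
      & forall a b, value_sort a = tau -> value_sort b = tau ->
          theory_interp (eq_sym tau) [:: a; b] = bool_value (a == b)]
}.

Inductive symbol (S : signature) :=
| Value of value S
| Theory of theory_sym S
| Term of term_sym S.

Arguments Value {S}.
Arguments Theory {S}.
Arguments Term {S}.

Definition sym_dom (S : signature) (f : symbol S) : seq (sort S) :=
  match f with
  | Value _ => [::]
  | Theory g => theory_dom g
  | Term g => term_dom g
  end.

Definition sym_cod (S : signature) (f : symbol S) : sort S :=
  match f with
  | Value a => value_sort a
  | Theory g => theory_cod g
  | Term g => term_cod g
  end.

Definition is_value_sym (S : signature) (f : symbol S) : bool :=
  if f is Value _ then true else false.

Definition is_theory_sym (S : signature) (f : symbol S) : bool :=
  if f is Term _ then false else true.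

(* Raw terms; well-sortedness is the separate predicate [well_sorted]. *)
Inductive term (S : signature) :=
| Var of var S
| App of symbol S & seq (term S).

Arguments Var {S}.
Arguments App {S}.

Definition term_sort (S : signature) (t : term S) : sort S :=
  match t with
  | Var x => var_sort x
  | App f _ => sym_cod f
  end.

Fixpoint well_sorted (S : signature) (t : term S) : bool :=
  match t with
  | Var _ => true
  | App f ts => (map (@term_sort S) ts == sym_dom f) && all (@well_sorted S) ts
  end.

Fixpoint all_symbols (S : signature) (P : pred (symbol S)) (t : term S) : bool :=
  match t with
  | Var _ => true
  | App f ts => P f && all (all_symbols P) ts
  end.

(* variable occurrences, from left to right, with repetitions *)
Fixpoint var_occs (S : signature) (t : term S) : seq (var S) :=
  match t with
  | Var x => [:: x]
  | App _ ts => flatten (map (@var_occs S) ts)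
  end.

Definition vars (S : signature) (t : term S) : set (var S) := [set` var_occs t].

Definition linear (S : signature) (t : term S) : bool := uniq (var_occs t).

Definition value_term (S : signature) (a : value S) : term S := App (Value a) [::].

Definition Val (S : signature) : set (term S) := range (@value_term S).

Definition value_free (S : signature) (t : term S) : bool :=
  all_symbols (fun f => ~~ is_value_sym f) t.

Fixpoint subterm (S : signature) (t : term S) (p : seq nat) : option (term S) :=
  match p with
  | [::] => Some t
  | i :: q =>
      if t is App _ ts then
        if onth ts i is Some t' then subterm t' q else None
      else None
  end.

Definition positions (S : signature) (t : term S) : set (seq nat) :=
  [set p | isSome (subterm t p)].

(* [replace t p u] is t[u]_p for p a position of t, and t otherwise. *)
Fixpoint replace (S : signature) (t : term S) (p : seq nat) (u : term S) : term S :=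
  match p with
  | [::] => u
  | i :: q =>
      if t is App f ts then
        if onth ts i is Some t' then App f (set_nth t' ts i (replace t' q u))
        else t
      else t
  end.

Definition Dom (S : signature) (sigma : var S -> term S) : set (var S) :=
  [set x | sigma x <> Var x].

Definition VDom (S : signature) (sigma : var S -> term S) : set (var S) :=
  [set x | Val (sigma x)].

Definition is_subst (S : signature) (sigma : var S -> term S) : Prop :=
  (forall x, well_sorted (sigma x) /\ term_sort (sigma x) = var_sort x)
  /\ finite_set (Dom sigma).

Fixpoint subst (S : signature) (sigma : var S -> term S) (t : term S) : term S :=
  match t with
  | Var x => sigma x
  | App f ts => App f (map (subst sigma) ts)
  end.

Definition valued (S : signature) (X : set (var S)) (sigma : var S -> term S) :=
  forall x, X x -> Val (sigma x).

(* Variables of non-theory sorts do not occur in constraints; what a valuation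
   does on them is irrelevant. *)
Definition valuation (S : signature) (v : var S -> value S) : Prop :=
  forall x, theory_sort (var_sort x) -> value_sort (v x) = var_sort x.

(* Term symbols, which do not occur in constraints, get an arbitrary value. *)
Fixpoint eval (S : signature) (v : var S -> value S) (t : term S) : value S :=
  match t with
  | Var x => v x
  | App f ts =>
      match f with
      | Value a => a
      | Theory g => theory_interp g (map (eval v) ts)
      | Term _ => bool_value S true
      end
  end.

Definition is_constraint (S : signature) (phi : term S) : Prop :=
  [/\ well_sorted phi, term_sort phi = bool_sort S
    & all_symbols (@is_theory_sym S) phi].

Definition and_term (S : signature) (phi psi : term S) : term S :=
  App (Theory (and_sym S)) [:: phi; psi].

Record exconstraint (S : signature) := Ex {
  bound : seq (var S);
  body : term S
}.

Arguments Ex {S}.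

Definition is_exconstraint (S : signature) (E : exconstraint S) : Prop :=
  is_constraint (body E) /\ [set` bound E] `<=` vars (body E).

Definition FVar (S : signature) (E : exconstraint S) : set (var S) :=
  vars (body E) `\` [set` bound E].

Definition ex_true (S : signature) (v : var S -> value S) (E : exconstraint S) :=
  exists w, [/\ valuation w,
                forall x, x \notin bound E -> w x = v x
              & eval w (body E) = bool_value S true].

Definition ex_valid (S : signature) (E : exconstraint S) : Prop :=
  forall v, valuation v -> ex_true v E.

Definition ex_satisfiable (S : signature) (E : exconstraint S) : Prop :=
  exists2 v, valuation v & ex_true v E.

Definition ex_implies (S : signature) (E F : exconstraint S) : Prop :=
  forall v, valuation v -> ex_true v E -> ex_true v F.

(* Bound variables are not renamed: this is used only when sigma maps the free
   variables to values, so that no capture can occur. *)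
Definition ex_subst (S : signature) (sigma : var S -> term S)
    (E : exconstraint S) : exconstraint S :=
  Ex (bound E)
     (subst (fun x => if x \in bound E then Var x else sigma x) (body E)).

Definition models (S : signature) (sigma : var S -> term S)
    (E : exconstraint S) : Prop :=
  valued (FVar E) sigma /\ ex_valid (ex_subst sigma E).

Record ecterm (S : signature) := ECTerm {
  ec_vars : set (var S);
  ec_term : term S;
  ec_constr : exconstraint S
}.

Arguments ECTerm {S}.

(* The variables in X are of theory sorts, as they stand for values. *)
Definition is_ecterm (S : signature) (C : ecterm S) : Prop :=
  [/\ well_sorted (ec_term C),
      is_exconstraint (ec_constr C),
      (forall x, ec_vars C x -> theory_sort (var_sort x)),
      FVar (ec_constr C) `<=` ec_vars C /\ ec_vars C `<=` vars (ec_term C)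
    & [set` bound (ec_constr C)] `&` vars (ec_term C) = set0].

Definition ec_satisfiable (S : signature) (C : ecterm S) : Prop :=
  ex_satisfiable (ec_constr C).

Record rule (S : signature) := Rule {
  rvars : set (var S);
  lhs : term S;
  rhs : term S;
  constr : term S
}.

Arguments Rule {S}.

Definition ExVar (S : signature) (rho : rule S) : set (var S) :=
  vars (rhs rho) `\` vars (lhs rho).

(* As for constrained terms, the variables in Z are of theory sorts. *)
Definition is_rule (S : signature) (rho : rule S) : Prop :=
  [/\ well_sorted (lhs rho) /\ well_sorted (rhs rho),
      term_sort (lhs rho) = term_sort (rhs rho),
      is_constraint (constr rho),
      (forall x, rvars rho x -> theory_sort (var_sort x))
    & vars (constr rho) `|` ExVar rho `<=` rvars rho].

Definition rule_vars (S : signature) (rho : rule S) : set (var S) :=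
  vars (lhs rho) `|` vars (rhs rho) `|` vars (constr rho).

Definition left_linear (S : signature) (rho : rule S) : bool :=
  linear (lhs rho).

Definition left_value_free (S : signature) (rho : rule S) : bool :=
  value_free (lhs rho).

Definition is_renaming (S : signature) (delta : var S -> var S) : Prop :=
  [/\ bijective delta,
      (forall x, var_sort (delta x) = var_sort x)
    & finite_set [set x | delta x <> x]].

Definition rename_rule (S : signature) (delta : var S -> var S) (rho : rule S) :
    rule S :=
  let s := subst (fun x => Var (delta x)) in
  Rule (delta @` rvars rho) (s (lhs rho)) (s (rhs rho)) (s (constr rho)).

Definition has_redex (S : signature) (C : ecterm S) (rho : rule S)
    (p : seq nat) (gamma : var S -> term S) : Prop :=
  [/\ Dom gamma = vars (lhs rho),
      subterm (ec_term C) p = Some (subst gamma (lhs rho)),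
      (forall x, (vars (lhs rho) `&` rvars rho) x ->
         Val (gamma x) \/ exists2 y, ec_vars C y & gamma x = Var y)
    & exists2 zs : seq (var S),
        [set` zs] = vars (constr rho) `\` vars (lhs rho)
        & ex_implies (ec_constr C) (Ex zs (subst gamma (constr rho)))].

Definition mg_step (S : signature) (rho : rule S) (p : seq nat)
    (gamma : var S -> term S) (C D : ecterm S) : Prop :=
  let t := replace (ec_term C) p (subst gamma (rhs rho)) in
  let psi := and_term (body (ec_constr C)) (subst gamma (constr rho)) in
  [/\ ec_satisfiable C /\ left_linear rho,
      rule_vars rho `&` (vars (ec_term C) `|` vars (body (ec_constr C))) = set0,
      is_subst gamma,
      has_redex C rho p gamma
    & exists2 ys : seq (var S),
        [set` ys] = vars psi `\` vars t
        & D = ECTerm (ExVar rho `|` (ec_vars C `&` vars t)) t (Ex ys psi)].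

Definition rule_step (S : signature) (rho : rule S) (C D : ecterm S) : Prop :=
  exists p gamma delta,
    is_renaming delta /\ mg_step (rename_rule delta rho) p gamma C D.

(* the rule f(x1,...,xn) -> y [y = f(x1,...,xn)] *)
Definition calculation_rule (S : signature) (f : theory_sym S)
    (xs : seq (var S)) (y : var S) : rule S :=
  let fx := App (Theory f) (map Var xs) in
  Rule [set` y :: xs] fx (Var y)
       (App (Theory (eq_sym (theory_cod f))) [:: Var y; fx]).

Definition has_calculation_rules (S : signature) (R : set (rule S)) : Prop :=
  forall f : theory_sym S, exists xs y,
    [/\ uniq (y :: xs), map (@var_sort S) xs = theory_dom f,
        var_sort y = theory_cod f & R (calculation_rule f xs y)].

Definition is_lctrs (S : signature) (R : set (rule S)) : Prop :=
  (forall rho, R rho -> is_rule rho /\ left_linear rho)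
  /\ has_calculation_rules R.

Definition lctrs_step (S : signature) (R : set (rule S)) (C D : ecterm S) : Prop :=
  exists2 rho, R rho & rule_step rho C D.

Definition normal_form (S : signature) (R : set (rule S)) (C : ecterm S) : Prop :=
  ~ exists D, lctrs_step R C D.

Definition pair_step (S : signature) (P : set (term S * term S)) (p : seq nat)
    (u v : term S) : Prop :=
  exists l r theta,
    [/\ P (l, r), is_subst theta, subterm u p = Some (subst theta l)
      & v = replace u p (subst theta r)].

Definition rule_interp (S : signature) (rho : rule S) : set (term S * term S) :=
  [set lr | exists sigma,
     [/\ is_subst sigma,
         Dom sigma = rvars rho `&` (vars (lhs rho) `|` vars (rhs rho)),
         VDom sigma = rvars rho `&` (vars (lhs rho) `|` vars (rhs rho)),
         exists2 zs : seq (var S),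
           [set` zs] = vars (constr rho) `\` (vars (lhs rho) `|` vars (rhs rho))
           & models sigma (Ex zs (constr rho))
       & lr = (subst sigma (lhs rho), subst sigma (rhs rho))]].

Definition value_interp (S : signature) (C : ecterm S) : set (term S) :=
  [set u | exists sigma,
     [/\ is_subst sigma /\ u = subst sigma (ec_term C),
         valued (ec_vars C) sigma,
         (forall x, (vars (ec_term C) `\` ec_vars C) x ->
            exists y, sigma x = Var y),
         (forall x y, (vars (ec_term C) `\` ec_vars C) x ->
            (vars (ec_term C) `\` ec_vars C) y -> x <> y -> sigma x <> sigma y)
       & models sigma (ec_constr C)]].

(* Main.v *)
(** A match of a left-hand side at a position, together with values for the
    variables of the rule that satisfy its constraint, is all that a step of the
    interpreted rule needs; after renaming, a most general step of the
    constrained term needs such a match [g] whose constraint is satisfied under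
    every valuation that satisfies the constraint of the term.  Such a symbolic
    match instantiates to a match of every member of the value interpretation.
    Conversely, one reducible member already determines [g]: members differ from
    the constrained term only by values and variables at variable positions,
    while the left-hand side is linear and contains no values.  Since [g] does
    not depend on the member, reducibility of all members, one valuation at a
    time, is the required implication between constraints. *)

Require Import Defs.
From mathcomp Require Import all_boot.
From Stdlib Require List.
From mathcomp Require Import boolp classical_sets functions cardinality.

Set Implicit Arguments.
Unset Strict Implicit.
Unset Printing Implicit Defensive.

Local Open Scope classical_set_scope.

Local Notation rename d := (subst (fun x => Var (d x))).

Lemma set_seqP (T : eqType) (xs : seq T) (A : set T) x :
  [set` xs] = A -> x \in xs <-> A x.
Proof. by move=> <-. Qed.

Section Terms.
Variable S : signature.
Implicit Types (t u l : term S) (s g : var S -> term S) (A : set (var S)).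

Definition sort_preserving A s : Prop :=
  forall x, A x -> well_sorted (s x) /\ term_sort (s x) = var_sort x.

Lemma nested_term_ind (P : term S -> Prop) :
  (forall x, P (Var x)) ->
  (forall f ts, List.Forall P ts -> P (App f ts)) -> forall t, P t.
Proof.
move=> PV PA; fix IH 1 => -[x|f ts]; first exact: PV.
apply: PA; elim: ts => [|t ts IHts]; first exact: List.Forall_nil.
by apply: List.Forall_cons; [exact: IH | exact: IHts].
Qed.

Lemma vars_Var (x : var S) : vars (Var x) = [set x].
Proof. exact: set_cons1. Qed.

Lemma finite_vars t : finite_set (vars t).
Proof. exact: finite_seq. Qed.

Lemma vars_diff_seq t A : exists xs : seq (var S), [set` xs] = vars t `\` A.
Proof.
by have /finite_seqP[xs ->] := finite_setD A (finite_vars t); exists xs.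
Qed.

Lemma eq_in_subst s1 s2 t :
  {in var_occs t, s1 =1 s2} -> subst s1 t = subst s2 t.
Proof.
elim/nested_term_ind: t => [x|f ts IH] /= eqs; first by apply: eqs; rewrite inE.
congr App; elim: IH eqs => //= t {}ts IHt _ IHts eqs.
by rewrite IHt ?IHts // => x xt; apply: eqs; rewrite mem_cat xt ?orbT.
Qed.

Lemma subst_inj_in s1 s2 t :
  subst s1 t = subst s2 t -> {in var_occs t, s1 =1 s2}.
Proof.
elim/nested_term_ind: t => [x|f ts IH] /=; first by move=> e y /[!inE] /eqP ->.
case; elim: IH => //= t {}ts IHt _ IHts [/IHt e1 /IHts e2] x.
by rewrite mem_cat => /orP[/e1|/e2].
Qed.

Lemma subst_Var t : subst Var t = t.
Proof.
elim/nested_term_ind: t => [//|f ts IH] /=; congr App.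
by elim: IH => //= t {}ts -> _ ->.
Qed.

Lemma subst_subst s1 s2 t :
  subst s1 (subst s2 t) = subst (fun x => subst s1 (s2 x)) t.
Proof.
elim/nested_term_ind: t => [//|f ts IH] /=; congr App.
by elim: IH => //= t {}ts -> _ ->.
Qed.

Lemma term_sort_subst s t :
  sort_preserving (vars t) s -> term_sort (subst s t) = term_sort t.
Proof. by case: t => [x /(_ x)[]|//]; rewrite ?vars_Var. Qed.

Lemma well_sorted_subst s t :
  sort_preserving (vars t) s -> well_sorted t -> well_sorted (subst s t).
Proof.
elim/nested_term_ind: t => [x /(_ x)[]|f ts IH] /=; rewrite ?vars_Var // => sP.
case/andP=> /eqP <- wts; suff [/eqP -> ->] :
  map (@term_sort S) (map (subst s) ts) = map (@term_sort S) ts /\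
  all (@well_sorted S) (map (subst s) ts) by [].
elim: IH wts sP => //= t {}ts IHt _ IHts /andP[wt wts] sP.
have tP : sort_preserving (vars t) s.
  by move=> x xt; apply: sP; rewrite /vars /= mem_cat; apply/orP; left.
have [|-> ->] := IHts wts.
  by move=> x xt; apply: sP; rewrite /vars /= mem_cat; apply/orP; right.
by rewrite term_sort_subst // IHt.
Qed.

Lemma well_sorted_subst_vars s t x :
  well_sorted (subst s t) -> vars t x -> well_sorted (s x).
Proof.
elim/nested_term_ind: t => [y|f ts IH] /=.
  by move=> wy; rewrite vars_Var => ->.
case/andP=> _; rewrite /vars /=.
elim: IH => //= t {}ts IHt _ IHts /andP[/IHt wt /IHts wts].
by rewrite mem_cat => /orP[/wt|/wts].
Qed.

Lemma var_occs_subst s t :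
  var_occs (subst s t) = flatten [seq var_occs (s x) | x <- var_occs t].
Proof.
elim/nested_term_ind: t => [x|f ts IH] /=; first by rewrite cats0.
by elim: IH => //= t {}ts -> _ ->; rewrite map_cat flatten_cat.
Qed.

Lemma vars_subst s t : vars (subst s t) = \bigcup_(x in vars t) vars (s x).
Proof.
apply/seteqP; split=> y; rewrite /vars /= var_occs_subst.
  by case/flatten_mapP=> x; exists x.
by case=> x xt yx; apply/flatten_mapP; exists x.
Qed.

Lemma vars_rename (d : var S -> var S) t : vars (rename d t) = d @` vars t.
Proof.
rewrite vars_subst -bigcup_imset1; apply: eq_bigcupr => x _; exact: vars_Var.
Qed.

Lemma linear_rename (d : var S -> var S) t :
  injective d -> linear (rename d t) = linear t.
Proof.
by move=> dI; rewrite /linear var_occs_subst flatten_map1 map_inj_uniq.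
Qed.

Lemma subterm_subst s t u p :
  subterm t p = Some u -> subterm (subst s t) p = Some (subst s u).
Proof.
elim: p t => [|i p IH] [x|f ts] //=; [by case=> <-|by case=> <-|].
by rewrite onth_map; case: onth => //= t /IH.
Qed.

Lemma subterm_hereditary (P : term S -> Prop) t u p :
  (forall f ts i t', onth ts i = Some t' -> P (App f ts) -> P t') ->
  subterm t p = Some u -> P t -> P u.
Proof.
move=> Parg; elim: p t => [|i p IH] [x|f ts] //=; [by case=> <-|by case=> <-|].
by case E: onth => [t|] // /IH{}IH /(Parg _ _ _ _ E).
Qed.

Lemma vars_subterm t u p : subterm t p = Some u -> vars u `<=` vars t.
Proof.
move=> tu.
apply: (subterm_hereditary (P := fun v => vars v `<=` vars t) _ tu) => //.
move=> f ts i v E; apply: subset_trans => x; rewrite /vars /=.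
elim: ts i E => [|t' ts IHts] [|i] //= => [[->] xv|/IHts tsv /tsv xv].
  by rewrite mem_cat xv.
by rewrite mem_cat xv orbT.
Qed.

Lemma well_sorted_subterm t u p :
  subterm t p = Some u -> well_sorted t -> well_sorted u.
Proof.
apply: (subterm_hereditary (P := fun v => well_sorted v)).
move=> f ts i t' E /= /andP[_ wts].
by rewrite -(onth_nth t' _ _ _ E); apply: (all_nthP t' wts); rewrite -onthTE E.
Qed.

Lemma subst_glue l ls g0 g1 :
  ~~ has (mem (var_occs l)) (flatten (map (@var_occs S) ls)) ->
  exists g, subst g l = subst g0 l /\ map (subst g) ls = map (subst g1) ls.
Proof.
move=> /hasPn disj.
exists (fun x => if x \in var_occs l then g0 x else g1 x); split.
  by apply: eq_in_subst => x ->.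
elim: ls disj => //= u ls IHls disj; congr cons; last first.
  by apply: IHls => x xls; apply: disj; rewrite mem_cat xls orbT.
by apply: eq_in_subst => x xu; rewrite ifN //; apply: disj; rewrite mem_cat xu.
Qed.

(* The condition on [s] keeps the function symbols of [l] from meeting those
   that [s] introduces; linearity lets the matches of the arguments be glued. *)
Lemma linear_match_of_instance (P : pred (symbol S)) l t s g :
  linear l -> all_symbols P l ->
  {in var_occs t, forall x, if s x is App f _ then ~~ P f else true} ->
  subst s t = subst g l -> exists g', t = subst g' l.
Proof.
move=> + + sP; move: t sP; elim/nested_term_ind: l => [x|f ls IH] t sP.
  by move=> _ _ _; exists (fun=> t).
move=> lin /= /andP[Pf Pls]; case: t sP => [x|f' ts] /= sP.
  by have := sP x; rewrite inE eqxx => /(_ isT) + e; rewrite e Pf.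
case=> -> e; suff [g' ->] : exists g', ts = map (subst g') ls by exists g'.
move: lin; rewrite /linear /=.
elim: IH Pls ts sP e => [|l {}ls IHl _ IHls] /= Pls ts.
  by case: ts => // _ _ _; exists Var.
case: ts => [//|t ts] /= sP [et ets]; case/andP: Pls => Pl Pls.
rewrite cat_uniq => /and3P[lin_l disj lin_ls].
have [|g0 ->] := IHl t _ lin_l Pl et.
  by move=> x xt; apply: sP; rewrite mem_cat xt.
have [|g1 ->] := IHls Pls ts _ ets lin_ls.
  by move=> x xt; apply: sP; rewrite mem_cat xt orbT.
by have [g' [<- <-]] := subst_glue g0 g1 disj; exists g'.
Qed.

Lemma sort_preserving_is_subst A s : is_subst s -> sort_preserving A s.
Proof. by case=> sP _ x _. Qed.

Lemma sort_preserving_comp A s g :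
  is_subst s -> sort_preserving A g -> sort_preserving A (subst s \o g).
Proof.
move=> sP gP x /gP[wg <-] /=; split.
  by apply: well_sorted_subst wg; exact: sort_preserving_is_subst.
by apply: term_sort_subst; exact: sort_preserving_is_subst.
Qed.

Lemma sort_preserving_patch A B s :
  sort_preserving A s -> sort_preserving B (patch Var A s).
Proof.
move=> sP x _; have [Ax|nAx] := pselect (A x); last by rewrite patchC ?mem_set.
by rewrite patchT ?mem_set //; exact: sP.
Qed.

Lemma is_subst_patch A s :
  finite_set A -> sort_preserving A s -> is_subst (patch Var A s).
Proof.
move=> finA sP; split=> [x|]; first exact: (@sort_preserving_patch A setT).
apply: sub_finite_set finA => x; rewrite /Dom /=.
by apply: contra_notP => nAx; rewrite patchC ?mem_set.
Qed.

Lemma Dom_patch A s : (forall x, A x -> s x <> Var x) -> Dom (patch Var A s) = A.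
Proof.
move=> sA; apply/seteqP; split=> x; rewrite /Dom /=.
  by apply: contra_notP => nAx; rewrite patchC ?mem_set.
by move=> Ax; rewrite patchT ?mem_set //; exact: sA.
Qed.

End Terms.

Section Valuations.
Variable S : signature.
Implicit Types (t : term S) (s : var S -> term S) (v w : var S -> value S).
Implicit Types (A : set (var S)) (E : exconstraint S).

Definition value_subst A v : var S -> term S := patch Var A (@value_term S \o v).

Definition is_model v t : Prop := valuation v /\ eval v t = bool_value S true.

Lemma eval_subst v s t : eval v (subst s t) = eval (fun x => eval v (s x)) t.
Proof.
elim/nested_term_ind: t => [//|[a|f|f] ts IH] //=; congr theory_interp.
by elim: IH => //= t {}ts -> _ ->.
Qed.

Lemma eq_in_eval v w t : {in var_occs t, v =1 w} -> eval v t = eval w t.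
Proof.
elim/nested_term_ind: t => [x|f ts IH] /= eqs; first by apply: eqs; rewrite inE.
case: f => // f; congr theory_interp; elim: IH eqs => //= t {}ts IHt _ IHts eqs.
by rewrite IHt ?IHts // => x xt; apply: eqs; rewrite mem_cat xt ?orbT.
Qed.

Lemma value_sort_eval v t :
  valuation v -> well_sorted t -> all_symbols (@is_theory_sym S) t ->
  theory_sort (term_sort t) -> value_sort (eval v t) = term_sort t.
Proof.
move=> vP; elim/nested_term_ind: t => [x _ _|[a|f|//] ts IH] //=.
  exact: vP.
case/andP=> /eqP dom wts thts _; apply: theory_interp_sort; rewrite -dom.
have := theory_dom_theory f; rewrite -{}dom.
elim: IH wts thts => //= t {}ts IHt _ IHts /andP[wt wts] /andP[tht thts].
by case/andP=> tht' thts'; rewrite IHt ?IHts.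
Qed.

Lemma valuation_patch A v w :
  valuation v ->
  (forall x, A x -> theory_sort (var_sort x) -> value_sort (w x) = var_sort x) ->
  valuation (patch v A w).
Proof.
move=> vP wA x thx; have [Ax|nAx] := pselect (A x).
  by rewrite patchT ?mem_set //; exact: wA.
by rewrite patchC ?mem_set //; exact: vP.
Qed.

Lemma valuation_of_subst s :
  is_subst s ->
  exists2 v, valuation v & forall x, VDom s x -> s x = value_term (v x).
Proof.
case=> sP _; suff /choice[v vP] : forall x, exists a,
    (theory_sort (var_sort x) -> value_sort a = var_sort x) /\
    (VDom s x -> s x = value_term a).
  by exists v => x; case: (vP x).
move=> x; have [_ sx] := sP x.
have [[a _ sa]|nVx] := pselect (VDom s x); first by exists a; rewrite -sx -sa.
have [thx|nthx] := boolP (theory_sort (var_sort x)).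
  by have [a aP] := carrier_nonempty thx; exists a.
by exists (bool_value S true).
Qed.

Lemma value_substT A v x : A x -> value_subst A v x = value_term (v x).
Proof. by move=> Ax; rewrite /value_subst patchT ?mem_set. Qed.

Lemma value_substC A v x : ~ A x -> value_subst A v x = Var x.
Proof. by move=> nAx; rewrite /value_subst patchC ?mem_set. Qed.

Lemma sort_preserving_value_subst A B v :
  (forall x, A x -> theory_sort (var_sort x)) -> valuation v ->
  sort_preserving B (value_subst A v).
Proof. by move=> Ath vP; apply: sort_preserving_patch => x /Ath /vP. Qed.

Lemma is_subst_value_subst A v :
  finite_set A -> (forall x, A x -> theory_sort (var_sort x)) -> valuation v ->
  is_subst (value_subst A v).
Proof. by move=> finA Ath vP; apply: is_subst_patch => // x /Ath /vP. Qed.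

Lemma Dom_value_subst A v : Dom (value_subst A v) = A.
Proof. exact: Dom_patch. Qed.

Lemma VDom_value_subst A v : VDom (value_subst A v) = A.
Proof.
apply/seteqP; split=> x; rewrite /VDom /=; last first.
  by move=> Ax; rewrite value_substT //; exists (v x).
by apply: contraPP => nAx; rewrite value_substC // => -[].
Qed.

Lemma eval_value_subst A v t : eval v (subst (value_subst A v) t) = eval v t.
Proof.
rewrite eval_subst; apply: eq_in_eval => x _.
by have [Ax|nAx] := pselect (A x); [rewrite value_substT | rewrite value_substC].
Qed.

Lemma value_subst_Val A v t :
  Val (subst (value_subst A v) t) -> Val t \/ exists2 y, A y & t = Var y.
Proof.
case: t => [y|f [|t ts]] /= tV; [|by left|by case: tV].
have [Ay|nAy] := pselect (A y); first by right; exists y.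
by move: tV; rewrite value_substC // => -[].
Qed.

Lemma models_ex_true s v E :
  valuation v -> (forall x, FVar E x -> s x = value_term (v x)) ->
  models s E <-> ex_true v E.
Proof.
move=> vP sv; have eval_ex_subst w : (forall x, x \notin bound E -> w x = v x) ->
    forall v0, {in bound E, v0 =1 w} ->
    eval v0 (body (ex_subst s E)) = eval w (body E).
  move=> wv v0 v0w; rewrite /= eval_subst; apply: eq_in_eval => x xE.
  case: ifPn => xb /=; first exact: v0w.
  by rewrite sv ?wv //; split=> //; exact/negP.
split=> [[_ /(_ v vP)[w [wP wv ew]]]|[w [wP wv ew]]].
  by exists w; split=> //; rewrite -ew (eval_ex_subst w).
split=> [x /sv ->|v0 v0P]; first by exists (v x).
exists (patch v0 [set` bound E] w); split.
- by apply: valuation_patch => // x _; exact: wP.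
- by move=> x /negP xb; rewrite patchC ?mem_set.
- by rewrite (eval_ex_subst w) // => x xb; rewrite patchT ?mem_set.
Qed.

End Valuations.

Section Renamings.
Variable S : signature.
Implicit Types (d : var S -> var S) (a b : var S).

Lemma rename_ruleK d d' : cancel d d' -> cancel (rename_rule d) (rename_rule d').
Proof.
move=> dK [Z l r pi]; have renameK t : rename d' (rename d t) = t.
  rewrite subst_subst -[RHS]subst_Var; apply: eq_in_subst => x _ /=.
  by rewrite dK.
rewrite /rename_rule /= !renameK image_comp; congr Rule.
by apply: eq_image_id => x _; exact: dK.
Qed.

Lemma rule_vars_rename d rho : rule_vars (rename_rule d rho) = d @` rule_vars rho.
Proof. by rewrite /rule_vars /= !vars_rename !image_setU. Qed.

Lemma is_renaming_comp d1 d2 :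
  is_renaming d1 -> is_renaming d2 -> is_renaming (d1 \o d2).
Proof.
move=> [bij1 sort1 fin1] [bij2 sort2 fin2]; split; first exact: bij_comp.
  by move=> x; rewrite /= sort1 sort2.
apply: (@sub_finite_set _ _ ([set x | d1 x <> x] `|` [set x | d2 x <> x])).
  move=> x /=; have [->|/eqP d2x] := eqVneq (d2 x) x; first by left.
  by right.
by rewrite finite_setU.
Qed.

Definition var_swap a b (x : var S) : var S :=
  if x == a then b else if x == b then a else x.

Lemma var_swapK a b : involutive (var_swap a b).
Proof.
move=> x; rewrite /var_swap /=; have [->|xa] := eqVneq x a.
  by have [->|] := eqVneq b a; rewrite ?eqxx.
by have [->|xb] := eqVneq x b; rewrite ?eqxx ?(negPf xa) ?(negPf xb).
Qed.

Lemma is_renaming_var_swap a b :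
  var_sort a = var_sort b -> is_renaming (var_swap a b).
Proof.
move=> ab; split; first by exists (var_swap a b); exact: var_swapK.
  move=> x; rewrite /var_swap /=; have [->//|_] := eqVneq x a.
  by have [->|] := eqVneq x b.
apply: (@sub_finite_set _ _ [set a; b]) (finite_set2 a b) => x.
rewrite /var_swap /=; case: eqP => [->|_]; first by left.
by case: eqP => [->|//]; right.
Qed.

Lemma fresh_renaming (A B : set (var S)) :
  finite_set A -> finite_set B ->
  exists2 d, is_renaming d & (d @` A) `&` B = set0.
Proof.
move=> /finite_seqP[xs ->] finB; elim: xs => [|a xs [d dP dxs]].
  exists id; last by rewrite set_nil image_set0 set0I.
  split=> //; first by exists id.
  by apply: sub_finite_set (finite_set0 _) => x /=.
have [_ sort_d _] := dP.
have fin : finite_set (B `|` (d @` [set` xs])).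
  by rewrite finite_setU; split=> //; apply: finite_image; exact: finite_seq.
have [b [ba nb]] :=
  infinite_setN0 (infinite_setD (@var_infinite S (var_sort a)) fin).
exists (var_swap (d a) b \o d).
  by apply: is_renaming_comp dP; apply: is_renaming_var_swap; rewrite sort_d.
apply/disjoints_subset => _ [x /predU1P xs_x <-] /=; rewrite /var_swap /=.
have [_ Bb|dxa] := eqVneq (d x) (d a); first by apply: nb; left.
have {xs_x}xs_x : x \in xs by case: xs_x dxa => // ->; rewrite eqxx.
have [dxb|_] := eqVneq (d x) b; first by case: nb; right; exists x.
by move/disjoints_subset: dxs; apply; exists x.
Qed.

End Renamings.

Section Redexes.
Variable S : signature.
Implicit Types (C : ecterm S) (rho : rule S) (t u : term S) (p : seq nat).

(* The substitution [g] is the composition of the two substitutions of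
   [pair_step] and [rule_interp]. *)
Definition concrete_redex rho t : Prop :=
  exists g w,
    [/\ sort_preserving (vars (lhs rho)) g,
        t = subst g (lhs rho),
        is_model w (constr rho)
      & forall x, (vars (lhs rho) `&` rvars rho) x -> g x = value_term (w x)].

(* Unlike [has_redex], this does not depend on the names of the variables of
   [rho]: [g] matters only on the left-hand side, and [w] is separate from [v]. *)
Definition symbolic_redex C rho t : Prop :=
  exists g,
    [/\ sort_preserving (vars (lhs rho)) g,
        t = subst g (lhs rho),
        (forall x, (vars (lhs rho) `&` rvars rho) x ->
           Val (g x) \/ exists2 y, ec_vars C y & g x = Var y)
      & forall v, valuation v -> ex_true v (ec_constr C) ->
          exists2 w, is_model w (constr rho) &
            forall x, (vars (lhs rho) `&` rvars rho) x -> w x = eval v (g x)].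

Lemma concrete_redex_of_pair_step rho p t u v :
  subterm u p = Some t -> pair_step (rule_interp rho) p u v ->
  concrete_redex rho t.
Proof.
move=> ut [_ [_ [theta [[tau [tauP _ tauV [zs zsE tauE] [-> ->]]] thetaP]]]].
rewrite {}ut subst_subst => -[->] _; have [w0 w0P w0E] := valuation_of_subst tauP.
have /(models_ex_true w0P)[|w [wP ww0 ew]] := tauE.
  by move=> x /tauE.1 Vx; exact: w0E.
exists (subst theta \o tau), w; split=> //.
  by apply: sort_preserving_comp => //; exact: sort_preserving_is_subst.
move=> x [xl Zx] /=; have /w0E -> : VDom tau x by rewrite tauV; split=> //; left.
by rewrite ww0 //=; apply/negP => /(set_seqP _ zsE)[_]; apply; left.
Qed.

Lemma pair_step_of_concrete_redex rho p t u :
  is_rule rho -> subterm u p = Some t -> concrete_redex rho t ->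
  exists v, pair_step (rule_interp rho) p u v.
Proof.
case: rho => Z l r pi [/= _ _ _ Zth piZ] ut [g [w [/= gP tE [wP ew] gw]]].
pose D := Z `&` (vars l `|` vars r).
have tauP : is_subst (value_subst D w).
  apply: is_subst_value_subst => // [|x [/Zth//]].
  by apply: finite_setIr; rewrite finite_setU; split; exact: finite_vars.
pose theta := patch Var (vars l `\` Z) g.
have [zs zsE] := vars_diff_seq pi (vars l `|` vars r).
exists (replace u p (subst theta (subst (value_subst D w) r))).
exists (subst (value_subst D w) l), (subst (value_subst D w) r), theta.
split=> //.
- exists (value_subst D w); split=> //=.
  + exact: Dom_value_subst.
  + exact: VDom_value_subst.
  exists zs => //; apply/(models_ex_true wP); last by exists w.
  move=> x [/= xpi xzs]; rewrite value_substT //; split.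
    by apply: piZ; left.
  by apply: contrapT => xlr; apply/xzs/(set_seqP _ zsE).
- apply: is_subst_patch; first by apply: finite_setD; exact: finite_vars.
  by move=> x [xl _]; exact: gP.
rewrite ut tE subst_subst; congr Some; apply: eq_in_subst => x xl.
have [Zx|nZx] := pselect (Z x).
  by rewrite value_substT ?gw //; split=> //; left.
by rewrite value_substC /= /theta ?patchT ?mem_set // => -[].
Qed.

Lemma pair_reducibleP rho p t u :
  is_rule rho -> subterm u p = Some t ->
  (exists v, pair_step (rule_interp rho) p u v) <-> concrete_redex rho t.
Proof.
move=> rhoP ut; split; last exact: pair_step_of_concrete_redex.
by case=> v; exact: concrete_redex_of_pair_step.
Qed.

Lemma value_interp_model C u :
  FVar (ec_constr C) `<=` ec_vars C -> value_interp C u ->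
  exists s v,
    [/\ is_subst s /\ u = subst s (ec_term C),
        valuation v, ex_true v (ec_constr C)
      & forall x, ec_vars C x -> s x = value_term (v x)].
Proof.
move=> FX [s [[sP uE] sX _ _ sE]]; have [v vP sv] := valuation_of_subst sP.
exists s, v; split=> //; last by move=> x /sX; exact: sv.
by apply: (models_ex_true vP _).1 sE => x /FX /sX; exact: sv.
Qed.

Lemma value_interp_value_subst C v :
  is_ecterm C -> valuation v -> ex_true v (ec_constr C) ->
  value_interp C (subst (value_subst (ec_vars C) v) (ec_term C)).
Proof.
case: C => X s E [/= _ _ Xth [FX Xs] _] vP vE; exists (value_subst X v); split.
- split=> //; apply: is_subst_value_subst => //.
  by apply: sub_finite_set Xs _; exact: finite_vars.
- by move=> x Xx; rewrite value_substT //; exists (v x).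
- by move=> x [_ nXx]; exists x; rewrite value_substC.
- by move=> x y [_ nXx] [_ nXy] xy; rewrite !value_substC // => -[].
- by apply/(models_ex_true vP) => // x /FX Xx; rewrite value_substT.
Qed.

Lemma concrete_redex_of_symbolic C rho s v t :
  is_subst s -> valuation v -> ex_true v (ec_constr C) ->
  (forall x, ec_vars C x -> s x = value_term (v x)) ->
  symbolic_redex C rho t -> concrete_redex rho (subst s t).
Proof.
move=> sP vP vE sv [g [gP -> gX /(_ v vP vE)[w wM wg]]].
exists (subst s \o g), w; split=> //.
- exact: sort_preserving_comp.
- by rewrite subst_subst.
move=> x lZx /=; rewrite wg //.
by case: (gX x lZx) => [[a _ <-] //|[y Xy ->]] /=; exact: sv.
Qed.

Lemma symbolic_redex_of_concrete C rho t :
  (forall x, ec_vars C x -> theory_sort (var_sort x)) -> ec_satisfiable C ->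
  left_linear rho -> left_value_free rho -> well_sorted t ->
  (forall v, valuation v -> ex_true v (ec_constr C) ->
     concrete_redex rho (subst (value_subst (ec_vars C) v) t)) ->
  symbolic_redex C rho t.
Proof.
move=> Xth [v0 v0P v0E] lin vf wt red.
have [g0 [w0 [g0P e0 _ g0w0]]] := red v0 v0P v0E.
have [x _|g tE] := linear_match_of_instance lin vf _ e0.
  have [Xx|nXx] := pselect (ec_vars C x); first by rewrite value_substT.
  by rewrite value_substC.
have s0P B := sort_preserving_value_subst (B := B) Xth v0P.
rewrite {}tE !subst_subst in wt e0 red *; have {}e0 := subst_inj_in e0.
exists g; split=> //.
- move=> x xl; split; first exact: well_sorted_subst_vars wt xl.
  by rewrite -(term_sort_subst (s0P _)) e0 //; case: (g0P x xl).
- move=> x lZx; apply: (@value_subst_Val _ _ v0); rewrite e0; last by case: lZx.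
  by rewrite g0w0 //; exists (w0 x).
move=> v vP vE; have [g1 [w [_ e1 wM g1w]]] := red v vP vE.
rewrite subst_subst in e1; exists w => // x lZx.
by rewrite -(eval_value_subst (ec_vars C)) (subst_inj_in e1) ?g1w //; case: lZx.
Qed.

Lemma symbolic_redexP C rho p t :
  is_ecterm C -> ec_satisfiable C -> is_rule rho -> left_linear rho ->
  left_value_free rho -> subterm (ec_term C) p = Some t ->
  symbolic_redex C rho t <->
  forall u, value_interp C u -> exists v, pair_step (rule_interp rho) p u v.
Proof.
move=> CP Csat rhoP lin vf st; have [ws _ Xth [FX _] _] := CP.
split=> [red u|red].
  case/(value_interp_model FX)=> s [v [[sP ->] vP vE sv]].
  apply/(pair_reducibleP rhoP (subterm_subst s st)).
  exact: concrete_redex_of_symbolic sP vP vE sv red.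
apply: symbolic_redex_of_concrete => //; first exact: well_sorted_subterm st ws.
move=> v vP vE; apply/(pair_reducibleP rhoP (subterm_subst _ st))/red.
exact: value_interp_value_subst.
Qed.

Lemma symbolic_redex_rename C rho d t :
  (forall x, var_sort (d x) = var_sort x) ->
  symbolic_redex C (rename_rule d rho) t -> symbolic_redex C rho t.
Proof.
move=> sort_d [g [/= gP -> gX red]].
have mem_d x : (vars (lhs rho) `&` rvars rho) x ->
    (vars (rename d (lhs rho)) `&` (d @` rvars rho)) (d x).
  by move=> [xl Zx]; rewrite vars_rename; split; exists x.
exists (g \o d); split=> [x xl||x /mem_d /gX //|v vP vE].
- by rewrite /= -sort_d; apply: gP; rewrite vars_rename; exists x.
- by rewrite subst_subst.
have [w [wP ew] wg] := red v vP vE.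
exists (w \o d); last by move=> x /mem_d /wg.
by split=> [x|]; [rewrite /= -sort_d; exact: wP | rewrite -ew eval_subst].
Qed.

Lemma symbolic_redex_of_has_redex C rho p gamma :
  ec_vars C `<=` vars (ec_term C) -> vars (constr rho) `<=` rvars rho ->
  rule_vars rho `&` vars (ec_term C) = set0 ->
  is_subst gamma -> has_redex C rho p gamma ->
  exists2 t, subterm (ec_term C) p = Some t & symbolic_redex C rho t.
Proof.
case: C rho => X s E [Z l r pi] /= Xs piZ disj [gP _].
move=> [/= gD sp gX [zs zsE imp]]; exists (subst gamma l) => //.
exists gamma; split=> [x _||x lZx|v vP /(imp v vP)[w [wP wv ew]]] //=.
  exact: gX.
have gZ x : Z x -> Val (gamma x) \/ exists y, gamma x = Var y.
  move=> Zx; have [xl|nxl] := pselect (vars l x).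
    by case: (gX x) => [//||[y _ gx]]; [left | right; exists y].
  by right; exists x; apply: contrapT => gx; apply: nxl; rewrite -gD.
exists (patch w Z (fun x => eval w (gamma x))).
  split.
    apply: valuation_patch => // x Zx; have [wgx <-] := gP x => thx.
    apply: value_sort_eval => //.
    by case: (gZ x Zx) => [[a _ <-]|[y ->]].
  rewrite -ew /= eval_subst; apply: eq_in_eval => x xpi.
  by rewrite patchT // mem_set //; exact: piZ.
move=> x [xl Zx]; rewrite patchT ?mem_set //.
case: (gX x) => [//|[a _ <-] //|[y Xy ->]] /=; apply: wv => /=.
apply/negP => /(set_seqP _ zsE)[ypi _].
by have : set0 y by rewrite -disj; split; [right | exact: Xs].
Qed.

Lemma has_redex_of_symbolic C rho p t :
  vars (constr rho) `<=` rvars rho ->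
  rule_vars rho `&` vars (ec_term C) = set0 ->
  subterm (ec_term C) p = Some t -> symbolic_redex C rho t ->
  exists2 gamma, is_subst gamma & has_redex C rho p gamma.
Proof.
case: C rho => X s E [Z l r pi] /= piZ disj sp [g [/= gP tE gX red]].
have gs x : vars l x -> vars (g x) `<=` vars s.
  move=> xl; apply: subset_trans (vars_subterm sp); rewrite tE vars_subst.
  by move=> y gy; exists x.
have fresh x : rule_vars (Rule Z l r pi) x -> ~ vars s x.
  by move=> xrho xs; have : set0 x by rewrite -disj.
have [zs zsE] := vars_diff_seq pi (vars l).
exists (patch Var (vars l) g).
  by apply: is_subst_patch => //; exact: finite_vars.
split=> /=.
- apply: Dom_patch => x xl gx; apply: (fresh x); first by left; left.
  by apply: (gs x xl); rewrite gx vars_Var.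
- rewrite sp tE; congr Some; apply: eq_in_subst => x xl.
  by rewrite patchT ?mem_set.
- by move=> x [xl Zx]; rewrite patchT ?mem_set //; exact: gX.
exists zs => // v vP vE; have [w [wP ew] wg] := red v vP vE.
exists (patch v [set` zs] w); split=> [|x /negP xzs|].
- by apply: valuation_patch => // x _; exact: wP.
- by rewrite patchC ?mem_set.
rewrite -ew /= eval_subst; apply: eq_in_eval => x xpi.
have [xl|nxl] := pselect (vars l x); last first.
  rewrite patchC ?mem_set //= patchT // mem_set //.
  by rewrite zsE.
rewrite patchT ?mem_set // wg; last by split=> //; exact: piZ.
apply: eq_in_eval => y yg; rewrite patchC // mem_set // => yzs.
apply: (fresh y); last exact: gs yg.
by right; move: yzs; rewrite zsE => -[].
Qed.

Lemma mg_step_of_redex C rho p gamma :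
  ec_satisfiable C -> left_linear rho ->
  rule_vars rho `&` (vars (ec_term C) `|` vars (body (ec_constr C))) = set0 ->
  is_subst gamma -> has_redex C rho p gamma ->
  exists D, mg_step rho p gamma C D.
Proof.
move=> Csat lin disj gP red.
pose t := replace (ec_term C) p (subst gamma (rhs rho)).
pose psi := and_term (body (ec_constr C)) (subst gamma (constr rho)).
have [ys ysE] := vars_diff_seq psi (vars t).
exists (ECTerm (ExVar rho `|` (ec_vars C `&` vars t)) t (Ex ys psi)).
by split=> //; exists ys.
Qed.

Lemma rule_stepP C rho :
  is_ecterm C -> ec_satisfiable C -> is_rule rho -> left_linear rho ->
  (exists D, rule_step rho C D) <->
  exists p t, subterm (ec_term C) p = Some t /\ symbolic_redex C rho t.
Proof.
move=> [_ _ _ [_ Xs] _] Csat [_ _ _ _ piZ] lin.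
have rename_piZ d : vars (rename d (constr rho)) `<=` d @` rvars rho.
  by rewrite vars_rename; apply: image_subset => x xpi; apply: piZ; left.
split=> [[D [p [gamma [d [[_ sort_d _] [_ disj gP red _]]]]]]|[p [t [st red]]]].
  have [||t st symb] := symbolic_redex_of_has_redex Xs _ _ gP red.
  - exact: rename_piZ.
  - by move: disj; rewrite setIUr setU_eq0 => -[].
  by exists p, t; split=> //; exact: symbolic_redex_rename symb.
have [||d dP disj] := @fresh_renaming _ (rule_vars rho)
    (vars (ec_term C) `|` vars (body (ec_constr C))).
- by rewrite !finite_setU; do ![split | exact: finite_vars].
- by rewrite finite_setU; split; exact: finite_vars.
have [[d' dK d'K] sort_d _] := dP; rewrite -rule_vars_rename in disj.
have {}red : symbolic_redex C (rename_rule d rho) t.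
  apply: (@symbolic_redex_rename _ _ d'); last by rewrite rename_ruleK.
  by move=> x; rewrite -sort_d d'K.
have [||gamma gP redex] := has_redex_of_symbolic _ _ st red.
- exact: rename_piZ.
- by move: disj; rewrite setIUr setU_eq0 => -[].
have [|D stepD] := mg_step_of_redex Csat _ disj gP redex.
  by rewrite /left_linear linear_rename //; exact: can_inj dK.
by exists D, p, gamma, d.
Qed.

End Redexes.

Theorem theorem6p7 (S : signature) (R : set (rule S)) (C : ecterm S)
    (R_lctrs : is_lctrs R)
    (R_left_linear : forall rho, R rho -> left_linear rho)
    (R_left_value_free : forall rho, R rho -> left_value_free rho)
    (C_ecterm : is_ecterm C)
    (C_satisfiable : ec_satisfiable C) :
  normal_form R C <->
  (forall (rho : rule S) (p : seq nat), R rho -> positions (ec_term C) p ->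
     exists2 u, value_interp C u &
       ~ exists v, pair_step (rule_interp rho) p u v).
Proof.
have R_rule rho : R rho -> is_rule rho by case/R_lctrs.1.
have stepP rho (Rrho : R rho) :=
  rule_stepP C_ecterm C_satisfiable (R_rule _ Rrho) (R_left_linear _ Rrho).
have redexP rho p t (Rrho : R rho) (st : subterm (ec_term C) p = Some t) :=
  symbolic_redexP C_ecterm C_satisfiable (R_rule _ Rrho) (R_left_linear _ Rrho)
    (R_left_value_free _ Rrho) st.
split=> [nf rho p Rrho|irr [D [rho Rrho stepD]]].
  rewrite /positions /=; case st: subterm => [t|//] _; apply: contrapT => red.
  apply: nf; suff /(stepP _ Rrho)[D] : exists p t,
      subterm (ec_term C) p = Some t /\ symbolic_redex C rho t by exists D, rho.
  exists p, t; split=> //; apply/(redexP _ _ _ Rrho st) => u Cu.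
  by apply: contrapT => irr_u; apply: red; exists u.
have /(stepP _ Rrho)[p [t [st /(redexP _ _ _ Rrho st) red]]] :
  exists D, rule_step rho C D by exists D.
have [|u Cu] := irr rho p Rrho; first by rewrite /positions /= st.
by apply; exact: red.
Qed.
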